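(* Let $\Gamma$ be an arbitrary finite quiver of reduced rank one. Then any connected component of $\Gamma$ contains at most one cycle which is not a loop.
   Context: A quiver $\Gamma$ has a vertex set $\Gamma^0$, an arrow set $\Gamma^1$, and source and target maps $s,t:\Gamma^1\to\Gamma^0$. A path is a sequence $(\alpha_1,\dots,\alpha_r)$ of arrows with $t(\alpha_i)=s(\alpha_{i+1})$. A cycle is an oriented cycle, i.e. a path whose source $s(\alpha_1)$ equals its target $t(\alpha_r)$; here cycles are understood as simple ones (the vertices $s(\alpha_1),\dots,s(\alpha_r)$ are pairwise distinct), two cycles differing by a cyclic rotation are the same cycle, and a loop is a cycle of length $1$. The reduced rank of a vertex $i$ is $\mathrm{rrank}(i)=\#\{\alpha\in\Gamma^1\mid t(\alpha)=i,\ s(\alpha)\neq i\}$, and the reduced rank of $\Gamma$ is $\max_{i\in\Gamma^0}\mathrm{rrank}(i)$. Connected components of $\Gamma$ are those of the undirected graph obtained by forgetting the orientation of all arrows, viewed as quivers with the inherited orientation. *)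

(* Defs.v *)
From mathcomp Require Import all_boot.

Set Implicit Arguments.
Unset Strict Implicit.
Unset Printing Implicit Defensive.

Record quiver := Quiver {
  vertex : finType;
  arrow : finType;
  src : arrow -> vertex;
  tgt : arrow -> vertex
}.

Section Quiver.

Variable G : quiver.
Implicit Types (a b : arrow G) (i j : vertex G) (c : seq (arrow G)).

Definition rrank i : nat := #|[set a | (tgt a == i) && (src a != i)]|.

Definition reduced_rank : nat := \max_(i : vertex G) rrank i.

Definition composable a b : bool := tgt a == src b.

(* The library predicate [cycle] holds of the empty sequence, which is not a
   cycle of a quiver. *)
Definition is_cycle c : bool :=
  [&& c != [::], cycle composable c & uniq (map (@src G) c)].

Definition is_loop c : bool := is_cycle c && (size c == 1).

(* A cycle is a sequence of arrows up to cyclic rotation. *)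
Definition same_cycle c c' : Prop := exists n, c' = rot n c.

Definition adjacent i j : bool :=
  [exists a, ((src a == i) && (tgt a == j)) || ((src a == j) && (tgt a == i))].

(* Vertex sets of the connected components; [connect adjacent] is an
   equivalence relation because [adjacent] is symmetric. *)
Definition components : {set {set vertex G}} :=
  equivalence_partition (connect adjacent) [set: vertex G].

Definition arrows_in (C : {set vertex G}) : {set arrow G} :=
  [set a | (src a \in C) && (tgt a \in C)].

Definition cycle_in (C : {set vertex G}) c : bool :=
  is_cycle c && all (mem (arrows_in C)) c.

End Quiver.

(* Main.v *)
Require Import Defs.
From mathcomp Require Import all_boot.

(** In reduced rank one every vertex [v] has at most one non-loop arrow into
    it, so following that arrow backwards is a partial function. Neighbouring
    vertices, hence all vertices of a connected component, have a common
    iterated ancestor. The vertex set of a cycle that is not a loop is closed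
    under taking ancestors, so two such cycles in one component share a vertex;
    each of them is then the backward orbit of the arrow into that vertex. *)

Section BackwardMap.

Set Implicit Arguments.
Unset Strict Implicit.

Variable G : quiver.
Implicit Types (a b : arrow G) (i j : vertex G) (c : seq (arrow G)).

Definition in_arrow i : option (arrow G) :=
  [pick a | (tgt a == i) && (src a != i)].

(** A vertex that no non-loop arrow enters is its own parent, so that [parent] is total and can be
    iterated. *)
Definition parent i : vertex G := oapp (@src G) i (in_arrow i).

Definition prev_arrow a : arrow G := odflt a (in_arrow (src a)).

Definition common_ancestor i j : Prop :=
  exists m n, iter m parent i = iter n parent j.

Lemma common_ancestor_sym i j : common_ancestor i j -> common_ancestor j i.
Proof. by move=> [m [n e]]; exists n, m. Qed.

Lemma common_ancestor_trans j i k :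
  common_ancestor i j -> common_ancestor j k -> common_ancestor i k.
Proof.
(* Both meeting points lie on the ancestor line of [j]; climbing further by [p] and [n] brings them
   to the same vertex. *)
move=> [m [n e]] [p [q e']]; exists (p + m), (n + q).
by rewrite !iterD e -e' -!iterD addnC.
Qed.

Lemma nonloop_cycle_arrow c a :
  is_cycle c -> ~~ is_loop c -> a \in c -> src a != tgt a.
Proof.
rewrite /is_loop => cyc; rewrite cyc /= => nl ac.
have /and3P[_ cc uc] := cyc; have [n s def_s] := rot_to ac.
move: cc uc nl; rewrite -(rot_cycle n) -(rot_uniq n) -(size_rot n) -map_rot def_s.
(* Rotated to the front, [a] is followed by some [b] with [src b = tgt a], and the sources of a
   cycle are distinct. *)
case: s {def_s} => [|b s] //= /andP[/eqP-> _] /andP[+ _] _.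
by rewrite inE negb_or => /andP[].
Qed.

Hypothesis rank_le1 : forall i, rrank i <= 1.

Lemma in_arrow_tgt a : src a != tgt a -> in_arrow (tgt a) = Some a.
Proof.
move=> nl; rewrite /in_arrow; case: pickP => [b bP|/(_ a)]; last by rewrite eqxx nl.
have /card_le1_eqP eq1 := rank_le1 (tgt a).
by congr Some; apply: eq1; rewrite inE ?eqxx ?bP.
Qed.

Lemma adjacent_common_ancestor i j : adjacent i j -> common_ancestor i j.
Proof.
have arr a : common_ancestor (src a) (tgt a).
  have [->|nl] := eqVneq (src a) (tgt a); first by exists 0, 0.
  by exists 0, 1; rewrite /= /parent in_arrow_tgt.
case/existsP=> a /orP[] /andP[/eqP<- /eqP<-] //.
exact: common_ancestor_sym.
Qed.

Lemma connect_common_ancestor i j :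
  connect (@adjacent G) i j -> common_ancestor i j.
Proof.
case/connectP=> p + ->; elim: p i => [|k p IHp] i /=; first by exists 0, 0.
case/andP=> /adjacent_common_ancestor ik /IHp.
exact: common_ancestor_trans.
Qed.

Section Cycle.

Variable c : seq (arrow G).
Hypotheses (cyc : is_cycle c) (nl : ~~ is_loop c).

(** The reversal appears because [prev_arrow] runs against the orientation. *)
Lemma prev_arrow_cycle : fcycle prev_arrow (rev c).
Proof.
have /and3P[_ cc _] := cyc; rewrite rev_cycle.
apply: (sub_in_cycle (P := mem c)) cc; last exact/allP.
move=> a b ac _ /eqP ab /=.
by rewrite /prev_arrow -ab in_arrow_tgt // (nonloop_cycle_arrow cyc).
Qed.

Lemma mem_cycle_tgt i : (i \in map (@src G) c) = (i \in map (@tgt G) c).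
Proof.
have /and3P[_ cc _] := cyc.
apply/mapP/mapP=> -[a ac ->].
  by exists (prev c a); [rewrite mem_prev | rewrite (eqP (prev_cycle cc ac))].
by exists (next c a); [rewrite mem_next | rewrite (eqP (next_cycle cc ac))].
Qed.

Lemma iter_parent_cycle n i :
  i \in map (@src G) c -> iter n parent i \in map (@src G) c.
Proof.
move=> ic; elim: n => //= n; rewrite {1}mem_cycle_tgt => /mapP[a ac ->].
by rewrite /parent in_arrow_tgt ?(nonloop_cycle_arrow cyc) //= map_f.
Qed.

Lemma in_arrow_cycle i :
  i \in map (@src G) c -> exists2 a, a \in c & in_arrow i = Some a.
Proof.
rewrite mem_cycle_tgt => /mapP[a ac ->]; exists a => //.
by rewrite in_arrow_tgt // (nonloop_cycle_arrow cyc).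
Qed.

(** A duplicate-free cycle of a function is, up to rotation, the orbit of any of its elements. *)
Lemma orbit_prev_arrow a :
  a \in c -> exists n, orbit prev_arrow a = rot n (rev c).
Proof.
have /and3P[_ _ /map_uniq uc] := cyc.
rewrite -mem_rev => ac; have [|n e] := orbit_rot_cycle prev_arrow_cycle _ ac.
  by rewrite rev_uniq.
by exists n.
Qed.

End Cycle.

(** Up to rotation, both reversed cycles are the orbit of [a] under [prev_arrow], which depends on
    [a] alone. *)
Lemma same_cycle_of_mem c c' a :
  is_cycle c -> ~~ is_loop c -> is_cycle c' -> ~~ is_loop c' ->
  a \in c -> a \in c' -> same_cycle c c'.
Proof.
move=> cyc nl cyc' nl' /(orbit_prev_arrow cyc nl)[m om].
case/(orbit_prev_arrow cyc' nl') => n; rewrite om => /(congr1 rev).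
rewrite !rev_rot !revK => /(canLR (rotrK n)) <-.
by rewrite /rotr rot_rot_add; eexists.
Qed.

End BackwardMap.

Theorem proposition2p4 (G : quiver) (hG : reduced_rank G = 1)
    (C : {set vertex G}) (hC : C \in components G)
    (c c' : seq (arrow G))
    (hc : cycle_in C c) (hcl : ~~ is_loop c)
    (hc' : cycle_in C c') (hcl' : ~~ is_loop c') :
  same_cycle c c'.
Proof.
have rank_le1 (i : vertex G) : rrank i <= 1.
  by rewrite -hG; apply: (leq_bigmax i).
have [cyc /allP cC] := andP hc; have [cyc' /allP cC'] := andP hc'.
have [x _ def_C] := imsetP hC.
have anc a : a \in arrows_in C -> common_ancestor x (src a).
  rewrite inE def_C !inE /= => /andP[xa _].
  exact: connect_common_ancestor.
have arr (d : seq (arrow G)) : is_cycle d -> exists a, a \in d.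
  by case/and3P; case: d => // a d; exists a; apply: mem_head.
have [[a ac] [a' ac']] := (arr c cyc, arr c' cyc').
have [m [n e]] : common_ancestor (src a) (src a').
  apply: common_ancestor_trans (anc a' (cC' a' ac')).
  exact/common_ancestor_sym/(anc a (cC a ac)).
(* The common ancestor of [src a] and [src a'] lies on both cycles; [b] and [b'] are the arrows by
   which they enter it, and both equal its [in_arrow]. *)
have [b bc eb] := in_arrow_cycle rank_le1 cyc hcl
  (iter_parent_cycle rank_le1 cyc hcl m (map_f _ ac)).
have [b' bc' eb'] := in_arrow_cycle rank_le1 cyc' hcl'
  (iter_parent_cycle rank_le1 cyc' hcl' n (map_f _ ac')).
apply: (same_cycle_of_mem rank_le1 cyc hcl cyc' hcl' bc).
by move: eb; rewrite e eb' => -[<-].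
Qed.
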